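(* Let $m<n$ be positive integers, let $A$ be a real $m\times n$ matrix of full rank (i.e. rank $m$, so that $AA^T$ is non-singular), let $b\in\mathbb{R}^m$, and let $u=(1,1,\dots,1)^T\in\mathbb{R}^n$. Assume $Au\neq 0$. Put $$\alpha^*=\frac{u^TA^T(AA^T)^{-1}b}{u^TA^T(AA^T)^{-1}Au},\qquad x_B=A^T(AA^T)^{-1}(b-Au\,\alpha^* ).$$ Then the vector $$s=x_B+u\,\alpha^*=A^T(AA^T)^{-1}(b-Au\,\alpha^* )+u\,\alpha^*$$ is the unique minimum variance solution of the system $Ax=b$; that is, $As=b$, and for every $z\in\mathbb{R}^n$ with $Az=b$ and $z\neq s$ one has $|\hat s|^2<|\hat z|^2$.
   Context: For $x\in\mathbb{R}^n$, $|x|^2=x^Tx$ is the squared Euclidean norm, $\mu_x=\frac{u^Tx}{u^Tu}=\frac1n\sum_{i=1}^n x_i$ is the arithmetic mean, $\bar x=u\mu_x$ is the constant part, and $\hat x=x-\bar x$ is the variable (zero mean) part. The (arithmetic) variance of $x$ is $|\hat x|^2=\sum_{i=1}^n(x_i-\mu_x)^2$. A minimum variance (MV) solution of a linear system is a solution whose variance $|\hat x|^2$ is minimal among all solutions of the system. *)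

(* Defs.v *)
From HB Require Import structures.
From mathcomp Require Import all_boot all_order all_algebra.
From mathcomp Require Import reals.

Set Implicit Arguments.
Unset Strict Implicit.
Unset Printing Implicit Defensive.

Import Order.TTheory GRing.Theory Num.Theory.
Local Open Scope ring_scope.

Section MinimumVariance.
Variable R : realType.

(* x^T y, read off as the entry of a 1 x 1 matrix. *)
Definition dotcv n (x y : 'cV[R]_n) : R := (x^T *m y) 0 0.

Definition sqnorm n (x : 'cV[R]_n) : R := dotcv x x.

Definition onescv n : 'cV[R]_n := const_mx 1.

(* Equal to n^-1 * \sum_i x i 0; for n = 0 it is 0 by the convention 0^-1 = 0. *)
Definition mean n (x : 'cV[R]_n) : R :=
  dotcv (onescv n) x / dotcv (onescv n) (onescv n).

Definition constant_part n (x : 'cV[R]_n) : 'cV[R]_n := mean x *: onescv n.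

Definition variable_part n (x : 'cV[R]_n) : 'cV[R]_n := x - constant_part x.

Definition variance n (x : 'cV[R]_n) : R := sqnorm (variable_part x).

Definition mv_solution m n (A : 'M[R]_(m, n)) (b : 'cV[R]_m) (x : 'cV[R]_n) :
    Prop :=
  A *m x = b /\
  forall z : 'cV[R]_n, A *m z = b -> variance x <= variance z.

(* invmx is total; below it is the true inverse as soon as \rank A = m. *)
Definition rpinv m n (A : 'M[R]_(m, n)) : 'M[R]_(n, m) :=
  A^T *m invmx (A *m A^T).

Definition alpha_star m n (A : 'M[R]_(m, n)) (b : 'cV[R]_m) : R :=
  dotcv (onescv n) (rpinv A *m b) /
  dotcv (onescv n) (rpinv A *m (A *m onescv n)).

Definition x_B m n (A : 'M[R]_(m, n)) (b : 'cV[R]_m) : 'cV[R]_n :=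
  rpinv A *m (b - alpha_star A b *: (A *m onescv n)).

End MinimumVariance.

Arguments onescv {R} n.

(* Main.v *)
(** Two solutions of [A x = b] differ by some [w] in the kernel of [A].  The
    choice of [alpha_star] makes [x_B] orthogonal to [u], so [x_B] is the
    variable part of [s]; and [x_B] lies in the row space of [A], so it is
    orthogonal to [w].  By Pythagoras [variance (s + w)] is
    [variance s + variance w], and [variance w = 0] forces [w] to be a multiple
    of [u], hence [w = 0] because [A u <> 0]. *)
Require Import Defs.
From HB Require Import structures.
From mathcomp Require Import all_boot all_order all_algebra.
From mathcomp Require Import reals.

Set Implicit Arguments.
Unset Strict Implicit.
Unset Printing Implicit Defensive.

Import Order.TTheory GRing.Theory Num.Theory.
Local Open Scope ring_scope.

Section DotProduct.
Variable R : realType.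

Lemma dotcvE n (x y : 'cV[R]_n) : dotcv x y = \sum_i x i 0 * y i 0.
Proof. by rewrite /dotcv mxE; apply: eq_bigr => i _; rewrite mxE. Qed.

Lemma dotcvC n (x y : 'cV[R]_n) : dotcv x y = dotcv y x.
Proof. by rewrite !dotcvE; apply: eq_bigr => i _; rewrite mulrC. Qed.

Lemma dotcvDr n (x y z : 'cV[R]_n) : dotcv x (y + z) = dotcv x y + dotcv x z.
Proof. by rewrite /dotcv mulmxDr mxE. Qed.

Lemma dotcvZr n a (x y : 'cV[R]_n) : dotcv x (a *: y) = a * dotcv x y.
Proof. by rewrite /dotcv -scalemxAr mxE. Qed.

Lemma dotcvBr n (x y z : 'cV[R]_n) : dotcv x (y - z) = dotcv x y - dotcv x z.
Proof. by rewrite -scaleN1r dotcvDr dotcvZr mulN1r. Qed.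

Lemma dotcv_trmx m n (A : 'M[R]_(m, n)) y x :
  dotcv (A^T *m y) x = dotcv y (A *m x).
Proof. by rewrite /dotcv trmx_mul trmxK mulmxA. Qed.

Lemma sqnorm_ge0 n (x : 'cV[R]_n) : 0 <= sqnorm x.
Proof. by rewrite /sqnorm dotcvE sumr_ge0 // => i _; rewrite -expr2 sqr_ge0. Qed.

Lemma sqnorm_eq0 n (x : 'cV[R]_n) : (sqnorm x == 0) = (x == 0).
Proof.
apply/eqP/eqP => [|->]; last by rewrite /sqnorm /dotcv mulmx0 mxE.
rewrite /sqnorm dotcvE => /eqP; rewrite psumr_eq0 => [/allP x0|i _].
  apply/matrixP => i j; rewrite ord1 mxE; apply/eqP.
  by have := x0 i (mem_index_enum i); rewrite mulf_eq0 orbb.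
by rewrite -expr2 sqr_ge0.
Qed.

Lemma sqnormD n (x y : 'cV[R]_n) :
  dotcv x y = 0 -> sqnorm (x + y) = sqnorm x + sqnorm y.
Proof.
move=> xy0; rewrite /sqnorm dotcvDr dotcvC dotcvDr (dotcvC (x + y)) dotcvDr.
by rewrite (dotcvC y) xy0 addr0 add0r.
Qed.

(** If a row [v] kills the Gram matrix [A *m A^T], then [v *m A *m A^T *m v^T], the squared norm of
    [(v *m A)^T], vanishes; so [v *m A = 0], and full row rank gives [v = 0]. *)
Lemma mulmx_trmx_unit m n (A : 'M[R]_(m, n)) :
  \rank A = m -> A *m A^T \in unitmx.
Proof.
move=> rkA; rewrite -row_free_unit; apply: inj_row_free => v vG0.
have A_free : row_free A by rewrite /row_free rkA.
apply: (row_free_inj A_free); rewrite mul0mx.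
apply: trmx_inj; rewrite trmx0; apply/eqP; rewrite -sqnorm_eq0.
by rewrite /sqnorm /dotcv trmxK trmx_mul mulmxA -(mulmxA v) vG0 mul0mx mxE.
Qed.

End DotProduct.

Section Variance.
Variable R : realType.

Lemma variable_partD n (x y : 'cV[R]_n) :
  variable_part (x + y) = variable_part x + variable_part y.
Proof.
rewrite /variable_part /constant_part /mean dotcvDr mulrDl scalerDl.
by rewrite opprD addrACA.
Qed.

Lemma sqnorm_onescv_neq0 n : (0 < n)%N -> sqnorm (onescv n : 'cV[R]_n) != 0.
Proof.
case: n => // n _; rewrite sqnorm_eq0; apply/eqP => /matrixP/(_ 0 0)/eqP.
by rewrite !mxE oner_eq0.
Qed.

Lemma variable_part_orthogonal n (x : 'cV[R]_n) a : (0 < n)%N ->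
  dotcv (onescv n) x = 0 -> variable_part (x + a *: onescv n) = x.
Proof.
move=> n_gt0 ux0; rewrite /variable_part /constant_part /mean dotcvDr dotcvZr.
by rewrite ux0 add0r mulfK ?sqnorm_onescv_neq0 // addrK.
Qed.

Lemma varianceD n (x w : 'cV[R]_n) a : (0 < n)%N ->
  dotcv (onescv n) x = 0 -> dotcv x w = 0 ->
  variance (x + a *: onescv n + w) = variance (x + a *: onescv n) + variance w.
Proof.
move=> n_gt0 ux0 xw0; rewrite /variance variable_partD.
rewrite variable_part_orthogonal // sqnormD //.
(* The cross term vanishes: [variable_part w] is a combination of [w] and [onescv n], both
   orthogonal to [x]. *)
by rewrite /variable_part dotcvBr dotcvZr (dotcvC x (onescv n)) ux0 xw0 mulr0 subr0.
Qed.

(** Zero variance means [w = mean w *: onescv n]; applying [A] gives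
    [mean w *: (A *m onescv n) = 0], so [mean w = 0]. *)
Lemma variance_kernel_gt0 m n (A : 'M[R]_(m, n)) w :
  A *m onescv n != 0 -> A *m w = 0 -> w != 0 -> 0 < variance w.
Proof.
move=> Au0 Aw0 w0; rewrite lt_def sqnorm_ge0 andbT sqnorm_eq0 subr_eq0.
apply: contra w0 => /eqP w_cst; move: Aw0; rewrite w_cst -scalemxAr => /eqP.
by rewrite !scaler_eq0 (negPf Au0) orbF => ->.
Qed.

(** For [x = onescv n] this is the denominator of [alpha_star]. The scalar is the squared norm of
    [A^T *m y] with [y] as set below; were it zero, [A *m x = A *m (A^T *m y)] would be zero too. *)
Lemma dotcv_rpinv_neq0 m n (A : 'M[R]_(m, n)) x :
  \rank A = m -> A *m x != 0 -> dotcv x (rpinv A *m (A *m x)) != 0.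
Proof.
move=> rkA; apply: contra => /eqP q0; have Gu := mulmx_trmx_unit rkA.
set y := invmx (A *m A^T) *m (A *m x).
have Gy : A *m (A^T *m y) = A *m x by rewrite mulmxA mulKVmx.
suff /eqP Ay0 : A^T *m y == 0 by rewrite -Gy Ay0 mulmx0.
by rewrite -sqnorm_eq0 /sqnorm dotcv_trmx Gy -dotcv_trmx dotcvC /y mulmxA q0.
Qed.

Lemma mulmx_rpinv m n (A : 'M[R]_(m, n)) :
  \rank A = m -> A *m rpinv A = 1%:M.
Proof. by move=> rkA; rewrite mulmxA mulmxV ?mulmx_trmx_unit. Qed.

(** As a function of the coefficient in [x_B], this dot product is affine with nonzero slope, and
    [alpha_star] is its root. *)
Lemma dotcv_onescv_x_B m n (A : 'M[R]_(m, n)) b :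
  \rank A = m -> A *m onescv n != 0 -> dotcv (onescv n) (x_B A b) = 0.
Proof.
move=> rkA Au0; rewrite /x_B mulmxBr dotcvBr -scalemxAr dotcvZr.
by rewrite divfK ?subrr ?dotcv_rpinv_neq0.
Qed.

Lemma dotcv_x_B_kernel m n (A : 'M[R]_(m, n)) b w :
  A *m w = 0 -> dotcv (x_B A b) w = 0.
Proof.
by move=> Aw0; rewrite /x_B -mulmxA dotcv_trmx Aw0 /dotcv mulmx0 mxE.
Qed.

End Variance.

Theorem lemma3 (R : realType) (m n : nat) (m_gt0 : (0 < m)%N) (m_lt_n : (m < n)%N)
    (A : 'M[R]_(m, n)) (b : 'cV[R]_m)
    (A_full_rank : \rank A = m) (Au_neq0 : A *m onescv n <> 0) :
  let s : 'cV[R]_n := x_B A b + alpha_star A b *: onescv n in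
  unique (mv_solution A b) s /\
  A *m s = b /\
  (forall z : 'cV[R]_n, A *m z = b -> z <> s -> variance s < variance z).
Proof.
move=> s; have n_gt0 : (0 < n)%N by apply: leq_trans m_lt_n.
move/eqP: Au_neq0 => Au0.
have As : A *m s = b.
  (* [rpinv A] is a right inverse of [A], so the two [alpha_star] terms cancel, whatever the value
     of that scalar. *)
  by rewrite /s mulmxDr -scalemxAr mulmxA mulmx_rpinv // mul1mx subrK.
have s_lt z : A *m z = b -> z <> s -> variance s < variance z.
  move=> Az /eqP z_s; have Aw0 : A *m (z - s) = 0 by rewrite mulmxBr Az As subrr.
  have -> : z = s + (z - s) by rewrite addrC subrK.
  rewrite varianceD ?dotcv_onescv_x_B ?dotcv_x_B_kernel //.
  by rewrite ltrDl (variance_kernel_gt0 Au0) // subr_eq0.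
split=> //; split=> [|z [Az z_min]].
  split=> // z Az; have [->|/eqP z_s] := eqVneq z s; first by [].
  exact/ltW/s_lt.
(* A second minimizer [z] would give [variance s < variance z <= variance s]. *)
apply/eqP; apply: contraT; rewrite eq_sym => /eqP z_s.
by have := lt_le_trans (s_lt z Az z_s) (z_min s As); rewrite ltxx.
Qed.
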